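(* For all $n\geq 1$ and $k\ge 0$, the number $b_{n,k}(123,231)$ of permutations $\pi\in\mathfrak{S}_n(123,231)$ with $\mathrm{bdes}(\pi)=k$ is $$b_{n,k}(123,231)=\begin{cases} n, & \text{if }k=0,\\ \binom{n-1}{2}, & \text{if }k=1,\\ 0, & \text{otherwise.}\end{cases}$$
   Context: $\mathfrak{S}_n$ is the set of permutations $\pi=\pi_1\pi_2\cdots\pi_n$ of $[n]=\{1,\dots,n\}$ in one-line notation. $\mathfrak{S}_n(123,231)$ is the set of $\pi\in\mathfrak{S}_n$ having no length-three subsequence with the same relative order as $123$ or as $231$. An index $k\in[n-1]$ is a big descent of $\pi\in\mathfrak{S}_n$ if $\pi_k>\pi_{k+1}+1$; $\mathrm{bdes}(\pi)$ is the number of big descents of $\pi$. *)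

(* Defs.v *)
From mathcomp Require Import all_boot all_fingroup.

Set Implicit Arguments.
Unset Strict Implicit.
Unset Printing Implicit Defensive.

(* A permutation of [n] in one-line notation is an element [pi] of ['S_n],
   where positions and values are shifted down by one: [pi i] is
   [pi_{i+1} - 1].  Patterns are one-line words over [nat]. *)

(* [f] lists the positions of a subsequence of [pi] order-isomorphic to
   [tau].  Comparing the entries at positions [i < j] is enough because the
   entries of [pi] are distinct and those of a pattern are meant to be. *)
Definition contains (n : nat) (tau : seq nat) (pi : 'S_n) : bool :=
  [exists f : {ffun 'I_(size tau) -> 'I_n},
    [forall i : 'I_(size tau), forall j : 'I_(size tau),
      (i < j) ==>
        (f i < f j) && ((pi (f i) < pi (f j)) == (nth 0 tau i < nth 0 tau j))]].

Definition avoiders (n : nat) (taus : seq (seq nat)) : {set 'S_n} :=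
  [set pi | all (fun tau => ~~ contains tau pi) taus].

(* The last position has no successor [l], so it is never a big descent. *)
Definition big_descent (n : nat) (pi : 'S_n) (k : 'I_n) : bool :=
  [exists l : 'I_n, (l == k.+1 :> nat) && (pi k > pi l + 1)].

Definition bdes (n : nat) (pi : 'S_n) : nat := #|[set k | big_descent pi k]|.

Definition bdes_count (n k : nat) (taus : seq (seq nat)) : nat :=
  #|[set pi in avoiders n taus | bdes pi == k]|.

(* Main.v *)
(** If an avoider has an ascent [pi d < pi d.+1], both patterns force the entries
    before [d.+1] and those from [d.+1] on to be decreasing and [pi d] to be
    minimal; moreover every entry before [d.+1] is either above or below all
    entries from [d.+1] on.  Hence [pi] consists of three decreasing runs of
    consecutive values, at positions [0, a), [a, c) and [c, n), the first run
    being the highest and the second one the lowest.  The only possible big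
    descent is at the end of the first run, so [bdes pi] is [0] or [1] according
    to whether [a = 0]. *)
Require Import Defs.
From mathcomp Require Import all_boot all_fingroup zify.

Set Implicit Arguments.
Unset Strict Implicit.
Unset Printing Implicit Defensive.

Lemma contains3P n (x y z : nat) (pi : 'S_n) :
  reflect (exists i j l : 'I_n,
             [/\ i < j, j < l, (pi i < pi j) = (x < y),
                 (pi j < pi l) = (y < z) & (pi i < pi l) = (x < z)])
          (contains [:: x; y; z] pi).
Proof.
apply: (iffP existsP) => [[f /forallP Hf]|[i [j [l [ij jl Hij Hjl Hil]]]]].
  have H (s t : 'I_3) : s < t -> (f s < f t) /\
      (pi (f s) < pi (f t)) = (nth 0 [:: x; y; z] s < nth 0 [:: x; y; z] t).
    by move=> st; move/forallP: (Hf s) => /(_ t); rewrite st /= => /andP[-> /eqP].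
  pose o0 : 'I_3 := @Ordinal 3 0 isT; pose o1 : 'I_3 := @Ordinal 3 1 isT.
  pose o2 : 'I_3 := @Ordinal 3 2 isT.
  have [h1 h2] := H o0 o1 isT; have [h3 h4] := H o1 o2 isT.
  by have [_ h6] := H o0 o2 isT; exists (f o0), (f o1), (f o2).
exists [ffun s : 'I_3 => nth i [:: i; j; l] s].
apply/forallP => -[[|[|[|s]]] hs] //; apply/forallP => -[[|[|[|t]]] ht] //=;
  by rewrite !ffunE /= ?ij ?jl ?(ltn_trans ij jl) ?Hij ?Hjl ?Hil eqxx.
Qed.

Lemma avoid_123_231P n (pi : 'S_n) :
  reflect (forall i j l : 'I_n, i < j -> j < l ->
             ~ (pi i < pi j /\ pi j < pi l) /\ ~ (pi l < pi i /\ pi i < pi j))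
          (pi \in avoiders n [:: [:: 1; 2; 3]; [:: 2; 3; 1]]).
Proof.
rewrite inE /= andbT; apply: (iffP andP) => [[/contains3P N1 /contains3P N2]|H].
  move=> i j l ij jl; split=> -[h1 h2]; [apply: N1|apply: N2];
    by exists i, j, l; split=> //; lia.
split; apply/contains3P => -[i [j [l [ij jl h1 h2 h3]]]].
  by have [h _] := H _ _ _ ij jl; apply: h; split; lia.
have [_ h] := H _ _ _ ij jl; apply: h; split; last lia.
(* Containing 231 only records that [pi i < pi l] fails; distinctness of the entries makes the
   reverse inequality strict. *)
have : pi i != pi l by rewrite (inj_eq perm_inj) -val_eqE /=; lia.
by rewrite -val_eqE /=; lia.
Qed.

Lemma card_ord_interval n l u : u <= n -> #|[set i : 'I_n | l <= i < u]| = u - l.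
Proof.
move=> un; rewrite -[RHS]muln1 -sum_nat_const_nat (big_nat_widen _ _ _ _ _ un).
rewrite (big_nat_widenl _ 0) // big_mkord -sum1dep_card.
by apply: eq_bigl => i; rewrite /= andbC.
Qed.

Lemma card_perm_below n (pi : 'S_n) (i : 'I_n) : #|[set j | pi j < pi i]| = pi i.
Proof.
have -> : [set j | pi j < pi i] = pi @^-1: [set v : 'I_n | 0 <= v < pi i].
  by apply/setP => j; rewrite !inE.
by rewrite card_preimset ?card_ord_interval ?subn0 //; [exact: ltnW|exact: perm_inj].
Qed.

(** An entry equals the number of entries below it, so the relative order determines the
    permutation. *)
Lemma perm_order_inj n (pi sigma : 'S_n) :
  (forall i j : 'I_n, i < j -> (pi i < pi j) = (sigma i < sigma j)) -> pi = sigma.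
Proof.
move=> H; apply/permP => i; apply: val_inj => /=.
rewrite -(card_perm_below pi) -(card_perm_below sigma).
apply: eq_card => j; rewrite !inE.
case: (ltngtP i j) => [ij|ji|/val_inj ->]; last by rewrite !ltnn.
  have := H _ _ ij.
  have : pi i != pi j by rewrite (inj_eq perm_inj) -val_eqE /=; lia.
  have : sigma i != sigma j by rewrite (inj_eq perm_inj) -val_eqE /=; lia.
  by rewrite -!val_eqE /=; lia.
exact: H.
Qed.

(* The second run has length [c - a], hence takes the values below [c - a]. *)
Definition three_runs (m a c i : nat) : nat :=
  if i < a then m - i else if i < c then c.-1 - i else m - i + (c - a).

Section ThreeRuns.
Variable m : nat.
Implicit Types p : 'I_m.+1 * 'I_m.+1.

(** [p] holds the starts of the second and third runs. If [p.1 < p.2], both are nonempty and the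
    unique ascent lies between them. The decreasing permutation has no ascent and is encoded by
    [(0, 0)] alone, which keeps the encoding injective. *)
Definition run_bounds p : bool := (p.1 < p.2) || (p.1 == 0 :> nat) && (p.2 == 0 :> nat).

(* The guard only makes the function injective outside [run_bounds] too. *)
Definition three_runs_ord p (i : 'I_m.+1) : 'I_m.+1 :=
  if run_bounds p then inord (three_runs m p.1 p.2 i) else i.

Lemma three_runs_ordE p i :
  run_bounds p -> three_runs_ord p i = three_runs m p.1 p.2 i :> nat.
Proof.
case: p => -[a ha] [c hc]; case: i => i hi; rewrite /three_runs_ord => H.
rewrite H inordK //; move: H; rewrite /run_bounds /three_runs /=.
by case: ifP; [|case: ifP]; lia.
Qed.

Lemma three_runs_ord_inj p : injective (three_runs_ord p).
Proof.
move=> i j; case: (boolP (run_bounds p)) => [H E|/negbTE H]; last first.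
  by rewrite /three_runs_ord H.
apply: val_inj; move/(congr1 val): E; rewrite /= !three_runs_ordE //.
case: p H i j => -[a ha] [c hc] H [i hi] [j hj]; move: H.
by rewrite /run_bounds /three_runs /=; do 4?[case: ifP]; lia.
Qed.

Definition three_runs_perm p : 'S_m.+1 := perm (@three_runs_ord_inj p).

Lemma three_runs_permE p i :
  run_bounds p -> three_runs_perm p i = three_runs m p.1 p.2 i :> nat.
Proof. by move=> H; rewrite permE three_runs_ordE. Qed.

(** Only pairs going from the second run to the third increase. Two such pairs cannot be chained,
    and what follows one lies in the third run, above the second. *)
Lemma three_runs_perm_avoids p : run_bounds p ->
  three_runs_perm p \in avoiders m.+1 [:: [:: 1; 2; 3]; [:: 2; 3; 1]].
Proof.
move=> H; apply/avoid_123_231P => i j l ij jl; rewrite !three_runs_permE //.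
move: H (ltn_ord i) (ltn_ord j) (ltn_ord l) (ltn_ord p.2).
by rewrite /run_bounds /three_runs; do 6?[case: ifP]; lia.
Qed.

Lemma three_runs_perm_inj : {in run_bounds &, injective three_runs_perm}.
Proof.
move=> p q hp hq /permP E.
have {}E i : i < m.+1 -> three_runs m p.1 p.2 i = three_runs m q.1 q.2 i.
  move=> hi; have /(congr1 val) := E (Ordinal hi).
  by rewrite /= !three_runs_permE.
case: p q hp hq E => -[a ha] [c hc] [[b hb] [d hd]]; rewrite !unfold_in /run_bounds /=.
move=> hp hq E.
(* A nonempty second run ends with the value 0 at position [c.-1], which determines [c]; the last
   entry [c - a] is then positive, unlike for [(0, 0)]. *)
have ecd : c = d.
  have := E c.-1 ltac:(lia); have := E d.-1 ltac:(lia); have := E m (leqnn _).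
  by rewrite /three_runs; do 8?[case: ifP]; lia.
(* The entry at position [c] is [m - a]. *)
have eab : a = b.
  have := E c ltac:(lia); have := E d ltac:(lia).
  by rewrite /three_runs; do 8?[case: ifP]; lia.
by congr (_, _); apply: val_inj.
Qed.

Lemma bdes_three_runs_perm p : run_bounds p -> bdes (three_runs_perm p) = (0 < p.1).
Proof.
move=> H.
have D (k : 'I_m.+1) :
    big_descent (three_runs_perm p) k = (0 < p.1) && (k == p.1.-1 :> nat).
  apply/existsP/andP => [[l /andP[/eqP kl]]|[a0 /eqP ka]].
    rewrite !three_runs_permE //.
    move: H (ltn_ord k) (ltn_ord l) (ltn_ord p.1) (ltn_ord p.2).
    by rewrite /run_bounds /three_runs; do 4?[case: ifP]; lia.
  (* The second run starts at [p.1], and the drop into it is [m - p.2 + 2], at least 2. *)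
  exists p.1; rewrite !three_runs_permE //.
  move: H (ltn_ord p.1) (ltn_ord p.2).
  by rewrite /run_bounds /three_runs; do 4?[case: ifP]; lia.
rewrite /bdes; case: (posnP p.1) => [a0|a0] /=.
  by apply: eq_card0 => k; rewrite !inE D a0.
have hk : p.1.-1 < m.+1 by have := ltn_ord p.1; lia.
rewrite -(cards1 (Ordinal hk)); apply: eq_card => k.
by rewrite !inE D a0 -val_eqE.
Qed.

Lemma avoider_three_runs (pi : 'S_m.+1) :
  pi \in avoiders m.+1 [:: [:: 1; 2; 3]; [:: 2; 3; 1]] ->
  exists2 p, run_bounds p & pi = three_runs_perm p.
Proof.
move/avoid_123_231P => A.
have neq (i j : 'I_m.+1) : i < j -> pi i <> pi j :> nat.
  by move=> ij /val_inj/perm_inj E; rewrite E ltnn in ij.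
have trans_desc : (forall d e : 'I_m.+1, e = d.+1 :> nat -> pi e < pi d) ->
    forall i j : 'I_m.+1, i < j -> pi j < pi i.
  move=> H i [j hj] /=; elim: j hj => // j IH hj; rewrite ltnS leq_eqVlt.
  have hj' : j < m.+1 by lia.
  have := H (Ordinal hj') (Ordinal hj) erefl => h.
  case/orP => [/eqP E|/(IH hj')]; last exact: ltn_trans.
  by have -> : i = Ordinal hj' by exact: val_inj.
case: (boolP [exists d : 'I_m.+1, [exists e : 'I_m.+1, (e == d.+1 :> nat) && (pi d < pi e)]]);
  last first.
  rewrite negb_exists => /forallP N.
  have D : forall i j : 'I_m.+1, i < j -> pi j < pi i.
    apply: trans_desc => d e E; move: (N d); rewrite negb_exists => /forallP/(_ e).
    by rewrite E eqxx /=; have := neq d e; lia.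
  exists (ord0, ord0); first by [].
  apply: perm_order_inj => i j ij; rewrite !three_runs_permE // /three_runs /=.
  by have := D i j ij; have := ltn_ord j; lia.
case/existsP => d /existsP[e /andP[/eqP ed de]].
(* Otherwise [i], [d], [e] form 123. *)
have low (i : 'I_m.+1) : i < d -> pi d < pi i.
  by move=> id; have := A i d e; have := neq i d; lia.
(* An increase from [i] to [j < d], followed by the lower entry at [d], would form 231. *)
have desc1 (i j : 'I_m.+1) : i < j -> j <= d -> pi j < pi i.
  move=> ij; rewrite leq_eqVlt => /orP[/eqP/val_inj Ej|jd]; first by subst j; apply: low.
  by have := A i j d; have := neq i j; have := low i; lia.
(* After [d], [e], an entry above [pi e] gives 123 and one below [pi d] gives 231. *)
have high (i : 'I_m.+1) : e < i -> pi d < pi i < pi e.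
  by move=> ei; have := A d e i; have := neq e i; have := neq d i; lia.
(* For [i] beyond [e], an increase from [i] to [j] would form 123 with [d]. *)
have desc3 (i j : 'I_m.+1) : e <= i -> i < j -> pi j < pi i.
  rewrite leq_eqVlt => /orP[/eqP/val_inj <- /high/andP[]//|ei ij].
  by have := A d i j; have := neq i j; have := high i; lia.
(* Otherwise [i], [e], [j] form 231. *)
have below (i j : 'I_m.+1) : i <= d -> pi i < pi e -> e <= j -> pi i < pi j.
  move=> id ie; rewrite leq_eqVlt => /orP[/eqP/val_inj <-//|ej].
  by have := A i e j; have := neq i j; lia.
have above (i j : 'I_m.+1) : i <= d -> pi e <= pi i -> e <= j -> pi j < pi i.
  move=> id ie; rewrite leq_eqVlt => /orP[/eqP/val_inj <-|/high]; last lia.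
  by have := neq i e; lia.
(* The second run starts at the first position [a] whose entry is below [pi e]; since the entries up
   to [d] decrease, those from [a] to [d] all stay below [pi e]. *)
case: (arg_minnP (P := fun i => pi i < pi e) val de) => a ae amin.
have ad : a <= d by exact: amin.
have before (i : 'I_m.+1) : i < a -> pi e <= pi i.
  by move=> ia; rewrite leqNgt; apply/negP => /amin /=; lia.
have after (i : 'I_m.+1) : a <= i -> i <= d -> pi i < pi e.
  rewrite leq_eqVlt => /orP[/eqP/val_inj <-//|ai id].
  by have := desc1 a i ai id; lia.
have H : run_bounds (a, e) by rewrite /run_bounds /=; lia.
exists (a, e) => //; apply: perm_order_inj => i j ij; rewrite !three_runs_permE //=.
have := ltn_ord j; have := ltn_ord e; rewrite /three_runs.
case: (leqP j d) => jd.
  by have := desc1 i j ij jd; do 4?[case: ifP]; lia.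
case: (leqP e i) => ei; first by have := desc3 i j ei ij; do 4?[case: ifP]; lia.
case: (ltnP i a) => ia.
  have := above i j; have := before i ia; do 4?[case: ifP]; lia.
have := below i j; have := after i ia; do 4?[case: ifP]; lia.
Qed.

Lemma bdes_count_run_bounds k :
  bdes_count m.+1 k [:: [:: 1; 2; 3]; [:: 2; 3; 1]] =
  #|[set p : 'I_m.+1 * 'I_m.+1 | run_bounds p & (0 < p.1) == k :> nat]|.
Proof.
rewrite /bdes_count -(card_in_imset (f := three_runs_perm)); last first.
  move=> p q; rewrite !inE => /andP[hp _] /andP[hq _].
  exact: three_runs_perm_inj.
apply: eq_card => pi; rewrite inE; apply/andP/imsetP => [[/avoider_three_runs[p hp ->]]|].
  by rewrite bdes_three_runs_perm // => hk; exists p => //; rewrite inE hp.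
case=> p; rewrite inE => /andP[hp hk] ->.
by rewrite three_runs_perm_avoids // bdes_three_runs_perm.
Qed.

End ThreeRuns.

(** Each second component [c] leaves [c.-1] choices for the first; Pascal's rule sums them. *)
Lemma card_pos_lt_pairs n :
  #|[set p : 'I_n * 'I_n | 0 < p.1 < p.2]| = 'C(n.-1, 2).
Proof.
have -> : #|[set p : 'I_n * 'I_n | 0 < p.1 < p.2]| = \sum_(c < n) c.-1.
  rewrite -sum1dep_card -(pair_big_dep xpredT (fun a c : 'I_n => 0 < a < c) (fun _ _ => 1)) /=.
  rewrite (exchange_big_dep xpredT) //=; apply: eq_bigr => c _.
  by rewrite sum1dep_card card_ord_interval ?subn1 // ltnW.
elim: n => [|n IH]; first by rewrite big_ord0.
rewrite big_ord_recr /= IH; case: n {IH} => //= n.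
by rewrite binS bin1.
Qed.

Theorem proposition3p12 (n k : nat) (hn : 1 <= n) :
  bdes_count n k [:: [:: 1; 2; 3]; [:: 2; 3; 1]] =
    match k with
    | 0 => n
    | 1 => 'C(n - 1, 2)
    | _ => 0
    end.
Proof.
case: n hn => // m _; rewrite bdes_count_run_bounds; case: k => [|[|k]].
(* Here [p.1 = 0], and every [p.2] is allowed, 0 included. *)
- rewrite -[RHS]card_ord -(card_imset (f := fun c : 'I_m.+1 => (ord0 : 'I_m.+1, c))); last first.
    by move=> c d [].
  apply: eq_card => -[a c]; rewrite inE; apply/idP/imsetP => [H|[d _ [-> ->]]].
    exists c => //; congr (_, _); apply: val_inj.
    by move: H; rewrite /run_bounds /=; lia.
  by rewrite /run_bounds /=; lia.
(* Once [p.1] is positive, [run_bounds p] amounts to [p.1 < p.2]. *)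
- rewrite subn1 -card_pos_lt_pairs; apply: eq_card => -[a c].
  by rewrite !inE /run_bounds /=; lia.
- by apply: eq_card0 => p; rewrite !inE; lia.
Qed.
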